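(* Let $G\in\mathbb{RH}_\infty$, let $0<\alpha<\beta$ be co-prime integers, and let $0<k<\infty$. Define the frequency $\omega:=\frac{\alpha\pi}{\beta}$ and the period $T:=2\beta$ if $\alpha$ is odd, $T:=\beta$ if $\alpha$ is even. Let $R(\omega)=\mathrm{Re}\{G(e^{j\omega})\}$ and $I(\omega)=\mathrm{Im}\{G(e^{j\omega})\}$. If $$R(\omega)+\frac{1}{k}<0\quad\text{and}\quad \frac{-|I(\omega)|}{R(\omega)+1/k}\le\tan\left(\frac{\pi}{T}\right),$$ then there exists $\phi\in S_{0,k}$ with $\phi(0)=0$ such that the Lurye system of $G$ and $\phi$ has a non-trivial $T$-periodic solution.
   Context: $j$ is the imaginary unit. $\mathbb{RH}_\infty$ is the space of real rational functions $G(z)$ with all poles inside the open unit disk (in particular proper, with no pole at infinity), i.e. transfer functions of stable, causal, discrete-time, single-input single-output linear time-invariant systems. The impulse response $g_0,g_1,g_2,\dots$ of $G$ is the real sequence with $G(z)=\sum_{k\ge 0} g_k z^{-k}$. For a bounded real input sequence $u=(u_i)_{i\in\mathbb{Z}}$, the output $y=Gu$ is $y_m=\sum_{i=-\infty}^{m} g_{m-i}u_i$, $m\in\mathbb{Z}$. For $0<k<\infty$, $S_{0,k}$ is the set of functions $\phi:\mathbb{R}\to\mathbb{R}$ with slope restricted to $[0,k]$: $0\le\frac{\phi(y_2)-\phi(y_1)}{y_2-y_1}\le k$ for all $y_2\ne y_1$. The Lurye system of $G$ and $\phi$ is the negative feedback interconnection $y=Gu$, $u_m=-\phi(y_m)$.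 A $T$-periodic solution is a pair of real sequences $(u_m)_{m\in\mathbb{Z}},(y_m)_{m\in\mathbb{Z}}$ with $u_{m+T}=u_m$ and $y_{m+T}=y_m$ for all $m$, satisfying $y=Gu$ and $u_m=-\phi(y_m)$ for all $m\in\mathbb{Z}$; it is non-trivial if it is not identically zero. *)

(* Defs.v *)
From HB Require Import structures.
From mathcomp Require Import all_boot all_order all_algebra.
From mathcomp Require Import complex.
From mathcomp Require Import all_classical all_reals all_analysis.

Set Implicit Arguments.
Unset Strict Implicit.
Unset Printing Implicit Defensive.

Import Order.TTheory GRing.Theory Num.Theory.
Import numFieldNormedType.Exports.

Local Open Scope classical_set_scope.
Local Open Scope ring_scope.
Local Open Scope complex_scope.

(* A real rational function in lowest terms, so that its finite poles are
   exactly the complex roots of the denominator; the size condition excludes a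
   pole at infinity (and, with coprimality, forces the denominator to be
   nonzero). *)
Record RHinf (R : realType) := {
  rh_num : {poly R};
  rh_den : {poly R};
  rh_coprime : coprimep rh_num rh_den;
  rh_proper : (size rh_num <= size rh_den)%N;
  rh_stable : forall z : R[i],
    root (map_poly (real_complex R) rh_den) z -> `|z| < 1
}.

Definition transfer (R : realType) (G : RHinf R) (z : R[i]) : R[i] :=
  (map_poly (real_complex R) (rh_num G)).[z] /
  (map_poly (real_complex R) (rh_den G)).[z].

(* G(z) = \sum_(k >= 0) g_k z^(-k) is required on the closed exterior of the
   unit disk, where a stable G has no pole; this determines g uniquely. The annotation
   R[i]^o gives R[i] the topology of its norm. *)
Definition impulse_response (R : realType) (G : RHinf R) : nat -> R :=
  get [set g : nat -> R | forall z : R[i], 1 <= `|z| ->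
    series (fun k => (g k)%:C * z ^- k : R[i]^o) @ \oo --> (transfer G z : R[i]^o)].

(* y = G u; the sum of g_(m - i) u_i over i <= m is indexed by k = m - i. *)
Definition is_output (R : realType) (G : RHinf R) (u y : int -> R) : Prop :=
  forall m : int,
    series (fun k : nat => impulse_response G k * u (m - k%:Z)) @ \oo --> y m.

Definition slope_restricted (R : realType) (k : R) (phi : R -> R) : Prop :=
  forall y1 y2 : R, y2 != y1 -> 0 <= (phi y2 - phi y1) / (y2 - y1) <= k.

Definition lurye_solution (R : realType) (G : RHinf R) (phi : R -> R)
    (u y : int -> R) : Prop :=
  is_output G u y /\ forall m : int, u m = - phi (y m).

Definition seq_periodic (R : realType) (T : nat) (u : int -> R) : Prop :=
  forall m : int, u (m + T%:Z) = u m.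

Definition has_nontrivial_periodic_solution (R : realType) (G : RHinf R)
    (phi : R -> R) (T : nat) : Prop :=
  exists u y : int -> R,
    [/\ seq_periodic T u, seq_periodic T y, lurye_solution G phi u y
      & ~ (forall m : int, u m = 0 /\ y m = 0)].

Definition freq (R : realType) (alpha beta : nat) : R :=
  alpha%:R * pi / beta%:R.

Definition period (alpha beta : nat) : nat :=
  if odd alpha then (2 * beta)%N else beta.

Definition freq_response (R : realType) (G : RHinf R) (w : R) : R[i] :=
  transfer G (cos w +i* sin w).

(* Main.v *)
Require Import Defs.
From HB Require Import structures.
From mathcomp Require Import all_boot all_order all_algebra.
From mathcomp Require Import complex.
From mathcomp Require Import all_classical all_reals all_analysis.
From mathcomp Require Import ring lra zify.

Set Implicit Arguments.
Unset Strict Implicit.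
Unset Printing Implicit Defensive.

Import Order.TTheory GRing.Theory Num.Theory.
Import numFieldNormedType.Exports.
Import ComplexField.Normc.

Local Open Scope classical_set_scope.
Local Open Scope ring_scope.

(** The periodic solution is a sampled cosine plus a constant,
    u_m = cos (w m) + c.  On a periodic input of this shape the system acts
    through its frequency response at w and at 0, so that
    y_m = Rw cos (w m) - Iw sin (w m) + G(1) c.  What remains is to find a
    nonlinearity through the finitely many points (y_m, - u_m).

    Take c = 0 for a moment.  The points (y_m, - u_m) lie on the graph of a
    function with slope in [0, k] as soon as any two of them are joined by a
    chord of slope in [0, k]; with X and Y the differences of cos (w m) and of
    sin (w m) between two instants, this chord condition reads
    X (H X - Iw Y) <= 0, where H = Rw + 1/k.  Put w = 2 pi a / T.  By the
    sum-to-product formulas the left-hand side is a square times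
    sin s (H sin s + Iw cos s), where s, half the sum of the two phases, is an
    integer multiple of pi / T.  On that grid either sin s = 0 or
    |sin s| >= sin (pi / T), that is |cos s| tan (pi / T) <= |sin s|, and then
    the hypothesis |Iw| <= - H tan (pi / T) makes the term H sin s dominate
    (sampled_orbit_monotone).  The phase of the cosine matters: starting it
    at 0 is what puts s on the grid.

    The interpolant is a finite minimum of ramps, truncated so as to be bounded
    (slope_in_interpolation).  It need not vanish at 0, and the constant c
    repairs this: replacing f by y |-> f (y - G(1) c) - c keeps the slopes,
    shifts the input by c and the output by G(1) c, and vanishes at 0 exactly
    when f (- G(1) c) = c.  Such a c exists by the intermediate value theorem,
    f being continuous and bounded (slope_in_fixpoint).  This treats odd and
    even alpha at once.

    The response to u is computed from the impulse response, which is defined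
    by a choice among the expansions of the transfer function on |z| >= 1; so
    one has to prove that there is one, up to and including the unit circle
    (impulse_response_cvg).  The functions with such an expansion are closed
    under addition and under division by z - p for |p| < 1: in the latter case
    the partial sums satisfy a linear recursion with multiplier p / z, a
    contraction.  An induction on the poles then covers all stable proper
    rational functions. *)

(** * Perturbed contractions *)

(** Once d is small, x stays below the geometric sequence x_N r^m plus the fixed
    point of the affine map t |-> r t + sup d. *)
Lemma contraction_cvg0 (R : realType) (r : R) (x d : nat -> R) :
    0 <= r < 1 -> (forall n, 0 <= x n) ->
    (forall n, x n.+1 <= r * x n + d n) ->
    d @ \oo --> 0 -> x @ \oo --> 0.
Proof.
move=> /andP[r_ge0 r_lt1] x_ge0 x_rec /cvgr0Pnorm_lt d_cvg0.
apply/cvgr0Pnorm_lt => e e_gt0.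
(* d below e / 2 * (1 - r) makes e / 2 a super-solution of the recursion. *)
have e'_gt0 : 0 < e / 2 * (1 - r) by rewrite mulr_gt0 ?divr_gt0 ?subr_gt0.
have [N _ d_small] := d_cvg0 _ e'_gt0.
have x_bound m : x (N + m)%N <= x N * r ^+ m + e / 2.
  elim: m => [|m IHm]; first by rewrite addn0 expr0 mulr1 lerDl ltW ?divr_gt0.
  have := x_rec (N + m)%N; rewrite -addnS => /le_trans; apply.
  have dm : d (N + m)%N <= e / 2 * (1 - r).
    by apply: le_trans (ler_norm _) (ltW (d_small _ _)); rewrite /= leq_addr.
  have := ler_wpM2l r_ge0 IHm; rewrite exprS; lra.
have := @cvg_geometric R (x N) r; rewrite ger0_norm// => /(_ r_lt1).
move=> /cvgr0Pnorm_lt /(_ (e / 2)) [|M _ geom_small]; first by rewrite divr_gt0.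
exists (N + M)%N => // n /= leNMn.
have NMn : n = (N + (n - N))%N by rewrite subnKC// (leq_trans (leq_addr _ _) leNMn).
rewrite NMn ger0_norm//; apply: le_lt_trans (x_bound _) _.
have /= := geom_small (n - N)%N; rewrite leq_subRL; last first.
  exact: leq_trans (leq_addr _ _) leNMn.
by move=> /(_ leNMn) /(le_lt_trans (ler_norm _)); rewrite /geometric /=; lra.
Qed.

(** The norm of R[i] takes its values in R[i]; this moves convergence to 0 to the
    real sequence of moduli, where estimates are made. *)
Lemma cvg0_normc (R : realType) (f : nat -> R[i]^o) :
  f @ \oo --> (0 : R[i]^o) <-> (fun n => normc (f n)) @ \oo --> (0 : R).
Proof.
split=> [/cvgr0Pnorm_lt f0|/cvgr0Pnorm_lt f0].
  apply/cvgr0Pnorm_lt => e e0; have := f0 e%:C%C; rewrite ltcR => /(_ e0).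
  apply: filterS => n /=; rewrite ltcR ger0_norm//.
  by rewrite -lecR; exact: (normr_ge0 (f n)).
apply/cvgr0Pnorm_lt => e; rewrite ltcE => /andP[/eqP /= Ime Ree].
have := f0 _ Ree; apply: filterS => n /= fn.
by rewrite ltcE /= Ime eqxx /=; apply: le_lt_trans (ler_norm _) fn.
Qed.

Lemma complex_contraction_cvg0 (R : realType) (q : R[i]) (e d : nat -> R[i]^o) :
    `|q| < 1 -> (forall n, e n.+1 = q * e n + d n) ->
    d @ \oo --> (0 : R[i]^o) -> e @ \oo --> (0 : R[i]^o).
Proof.
have nc_ge0 (z : R[i]) : 0 <= normc z by rewrite -lecR; exact: (normr_ge0 z).
rewrite ltcR => q_lt1 e_rec /cvg0_normc d0; apply/cvg0_normc.
apply: (@contraction_cvg0 _ (normc q)) d0; first by rewrite nc_ge0 q_lt1.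
  by move=> n; exact: nc_ge0.
by move=> n; rewrite e_rec (le_trans (le_normcD _ _))// normcM.
Qed.

(** * Expansions in powers of 1/z *)

Lemma complex_subr_cvg0 (R : realType) (f : nat -> R[i]^o) (a : R[i]^o) :
  (fun n => f n - a) @ \oo --> (0 : R[i]^o) <-> f @ \oo --> a.
Proof. exact: (@subr_cvg0 R[i] R[i]^o nat \oo). Qed.

(** Only pointwise convergence is asked, not absolute convergence: this is enough
    for the closure properties below, circle |z| = 1 included. *)
Definition zseries (R : realType) (F : R[i] -> R[i]) (h : nat -> R[i]) : Prop :=
  forall z : R[i], 1 <= `|z| ->
    series (fun k => h k * z ^- k : R[i]^o) @ \oo --> (F z : R[i]^o).

Lemma zseries_const (R : realType) (c : R[i]) :
  zseries (fun=> c) (fun k => if k == 0%N then c else 0).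
Proof.
move=> z _; apply: cvg_near_cst; exists 1%N => // -[//|n] _ /=.
rewrite seriesEnat /= big_nat_recl// big1 ?addr0; last by move=> i _; rewrite mul0r.
by rewrite expr0 invr1 mulr1.
Qed.

Lemma zseriesD (R : realType) (F1 F2 : R[i] -> R[i]) (h1 h2 : nat -> R[i]) :
    zseries F1 h1 -> zseries F2 h2 ->
  zseries (fun z => F1 z + F2 z) (fun k => h1 k + h2 k).
Proof.
move=> F1h1 F2h2 z z1; have := cvgD (FF := eventually_filter) (F1h1 z z1) (F2h2 z z1).
set S12 := (_ + _)%R.
suff -> : S12 = series (fun k => (h1 k + h2 k) * z ^- k : R[i]^o); first exact.
apply/funext => n; symmetry.
transitivity (\sum_(0 <= i < n) (h1 i * z ^- i + h2 i * z ^- i)).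
  by apply: eq_bigr => i _; rewrite mulrDl.
by rewrite big_split.
Qed.

(** The Taylor coefficients in 1/z of K(z) = H(z) / (z - p), where H has
    coefficients h: identify coefficients in z K = p K + H. *)
Fixpoint delayed_filter (R : realType) (p : R[i]) (h : nat -> R[i])
    (k : nat) : R[i] :=
  if k is k'.+1 then p * delayed_filter p h k' + h k' else 0.

(** The errors of the partial sums of the quotient obey
    e_(n+1) = (p / z) e_n + d_n with d_n -> 0, and |p / z| < 1 on |z| >= 1. *)
Lemma zseries_divXsub (R : realType) (p : R[i]) (F : R[i] -> R[i])
    (h : nat -> R[i]) :
    `|p| < 1 -> zseries F h ->
  zseries (fun z => F z / (z - p)) (delayed_filter p h).
Proof.
move=> p_lt1 Fh z z_ge1.
have z_gt0 : 0 < `|z| by rewrite (lt_le_trans ltr01).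
have z_neq0 : z != 0 by rewrite -normr_gt0.
have zp_neq0 : z - p != 0.
  by rewrite subr_eq0; apply: contraTneq p_lt1 => <-; rewrite le_gtF.
set S' := series _; pose S := series (fun k => h k * z ^- k : R[i]^o).
have S'S n : S' n.+1 = z^-1 * (p * S' n + S n).
  rewrite /S' /S seriesEnat /= big_nat_recl//= mul0r add0r seriesEnat /=.
  rewrite mulr_sumr -big_split mulr_sumr; apply: eq_bigr => i _ /=.
  by rewrite exprS invfM; ring.
apply: (complex_subr_cvg0 S' (F z / (z - p))).1.
apply: (@complex_contraction_cvg0 R (p / z) _ (fun n => (S n - F z) * z^-1)).
- by rewrite normf_div ltr_pdivrMr// mul1r (lt_le_trans p_lt1).
- by move=> n; rewrite S'S; field; rewrite z_neq0.
- rewrite -(mul0r z^-1); apply: (@cvgMr_tmp R[i]).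
  by apply: (complex_subr_cvg0 S (F z)).2; exact: Fh.
Qed.

(** Induction on the poles: with N = Q (X - p) + N(p), the quotient of N by
    (X - p) D is Q / D plus 1 / (z - p) times the quotient of a constant by D. *)
Lemma zseries_ratio (R : realType) (s : seq R[i]) (N : {poly R[i]}) :
    (forall p, p \in s -> `|p| < 1) -> (size N <= (size s).+1)%N ->
  exists h, zseries (fun z => N.[z] / (\prod_(p <- s) ('X - p%:P)).[z]) h.
Proof.
elim: s N => [|p s IHs] N /= s_lt1 sizeN.
  have [c ->] : exists c, N = c%:P by exists N`_0; exact: size1_polyC.
  exists (fun k => if k == 0%N then c else 0) => z z1.
  by rewrite big_nil !hornerE divr1; exact: zseries_const.
have p_lt1 : `|p| < 1 by rewrite s_lt1// mem_head.
have {}IHs (M : {poly R[i]}) : (size M <= (size s).+1)%N -> _ :=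
  IHs M (fun q qs => s_lt1 q (@mem_behead _ (p :: s) q qs)).
have Xp_neq0 : 'X - p%:P != 0 :> {poly R[i]} by rewrite polyXsubC_eq0.
have [hQ hQP] : exists h, zseries (fun z => (N %/ ('X - p%:P)).[z] /
    (\prod_(q <- s) ('X - q%:P)).[z]) h.
  by apply: IHs; rewrite size_divp// size_XsubC leq_subLR add1n.
have [hc hcP] : exists h, zseries (fun z => (N.[p]%:P).[z] /
    (\prod_(q <- s) ('X - q%:P)).[z]) h.
  by apply: IHs; rewrite (leq_trans (size_polyC_leq1 _)).
exists (fun k => hQ k + delayed_filter p hc k) => z z1.
have zq_neq0 q : q \in p :: s -> z - q != 0.
  move=> /s_lt1 q_lt1; rewrite subr_eq0.
  by apply: contraTneq q_lt1 => <-; rewrite le_gtF.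
have := zseriesD hQP (zseries_divXsub p_lt1 hcP) z1.
rewrite [X in _ --> X -> _](_ : _ = N.[z] / (\prod_(q <- p :: s) ('X - q%:P)).[z])//.
rewrite big_cons; set D := \prod_(q <- s) _.
have Dz_neq0 : D.[z] != 0.
  rewrite horner_prod prodf_seq_neq0; apply/allP => q qs /=.
  by rewrite !hornerE zq_neq0// in_cons qs orbT.
have zp_neq0 := zq_neq0 p (mem_head _ _).
have -> : N.[z] = (N %/ ('X - p%:P)).[z] * (z - p) + N.[p].
  by rewrite {1}(divp_eq N ('X - p%:P)) modp_XsubC !hornerE.
rewrite hornerM hornerXsubC hornerC.
by field; rewrite Dz_neq0 zp_neq0.
Qed.

(** * The impulse response of a stable system *)

Lemma cvg_conjc (R : realType) (f : nat -> R[i]^o) (a : R[i]^o) :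
  f @ \oo --> a -> (fun n => (f n)^*%C : R[i]^o) @ \oo --> (a^*%C : R[i]^o).
Proof.
move=> fa; have {fa}/cvg0_normc fa := (complex_subr_cvg0 f a).2 fa.
apply: (complex_subr_cvg0 (fun n => (f n)^*%C : R[i]^o) _).1; apply/cvg0_normc.
rewrite [X in X @ _](_ : _ = fun n => normc (f n - a)) //.
by apply/funext => n; rewrite -rmorphB; apply: complexI; exact: normcJ.
Qed.

Lemma zseries_conj (R : realType) (F : R[i] -> R[i]) (h : nat -> R[i]) :
  zseries F h -> zseries (fun z => (F z^*)^*)%C (fun k => (h k)^*%C).
Proof.
move=> Fh z z1.
have zJ1 : 1 <= `|z^*%C| by rewrite normcJ.
have := cvg_conjc (Fh _ zJ1); set S := (X in X @ _).
suff -> : S = series (fun k => (h k)^*%C * z ^- k : R[i]^o) by [].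
apply/funext => n; rewrite /S /series /= (rmorph_sum (@conjc R)).
by apply: eq_bigr => i _; rewrite rmorphM fmorphV rmorphXn /= conjcK.
Qed.

(** A function that commutes with conjugation is expanded by h and by the
    conjugate of h, hence by their average. *)
Lemma zseries_real (R : realType) (F : R[i] -> R[i]) (h : nat -> R[i]) :
    (forall z, (F z^*)^*%C = F z)%C -> zseries F h ->
  zseries F (fun k => (complex.Re (h k))%:C%C).
Proof.
move=> FJ Fh z z1.
have := cvgMl_tmp (FF := eventually_filter) (a := 2^-1 : R[i])
  (zseriesD Fh (zseries_conj Fh) z1).
rewrite FJ; set S := (X in X @ _).
rewrite [X in _ --> X -> _](_ : _ = F z); last by field.
suff -> : S = series (fun k => (complex.Re (h k))%:C%C * z ^- k : R[i]^o) by [].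
apply/funext => n; rewrite /S /series /= mulr_sumr.
by apply: eq_bigr => i _; rewrite ReJ_add mulrA [2^-1 * _]mulrC.
Qed.

Lemma transfer_conj (R : realType) (G : RHinf R) (z : R[i]) :
  ((transfer G z^*)^* = transfer G z)%C.
Proof.
have hornerJ (p : {poly R}) : ((map_poly (real_complex R) p).[z^*] ^* =
    (map_poly (real_complex R) p).[z])%C.
  rewrite -(horner_map (@conjc R)) /= conjcK -map_poly_comp; congr _.[z].
  by apply: eq_map_poly => x; exact: conjc_real.
by rewrite /transfer rmorphM fmorphV /= !hornerJ.
Qed.

Lemma rh_den_neq0 (R : realType) (G : RHinf R) : rh_den G != 0.
Proof.
apply/negP => /eqP den0; have := rh_proper G; rewrite den0 size_poly0 leqn0.
rewrite size_poly_eq0 => /eqP num0; have := rh_coprime G.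
by rewrite den0 num0 coprimep0 eqp01.
Qed.

(** Over R[i] the denominator splits and its roots are the poles, so zseries_ratio
    gives a complex expansion, which zseries_real makes real. *)
Lemma impulse_response_cvg (R : realType) (G : RHinf R) :
  zseries (transfer G) (fun k => (impulse_response G k)%:C%C).
Proof.
suff [g gP] : exists g : nat -> R, zseries (transfer G) (fun k => (g k)%:C%C).
  exact: (@getPex _ [set g | zseries (transfer G) (fun k => (g k)%:C%C)]
    (ex_intro _ g gP)).
pose den := map_poly (real_complex R) (rh_den G).
have den_neq0 : den != 0 by rewrite map_poly_eq0 rh_den_neq0.
have [s den_s] := closed_field_poly_normal den.
have lc_neq0 : lead_coef den != 0 by rewrite lead_coef_eq0.
have [p s_p||h hP] := @zseries_ratio R s
  ((lead_coef den)^-1 *: map_poly (real_complex R) (rh_num G)).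
- apply: (@rh_stable R G); rewrite -/den den_s rootZ// root_prod_XsubC.
  exact: s_p.
- rewrite (leq_trans (size_scale_leq _ _))// size_map_poly.
  rewrite (leq_trans (rh_proper G))// -(size_map_poly (real_complex R)) -/den.
  by rewrite den_s size_scale// size_prod_XsubC.
exists (fun k => complex.Re (h k)); apply: zseries_real (transfer_conj G) _.
move=> z z1; have := hP z z1.
rewrite [X in _ --> X -> _](_ : _ = transfer G z)//.
rewrite /transfer -/den (_ : den.[z] = lead_coef den *
  (\prod_(p <- s) ('X - p%:P)).[z]); last by rewrite {1}den_s hornerZ.
by rewrite hornerZ invfM mulrCA mulrA.
Qed.

Lemma ReD (R : realType) : {morph @complex.Re R : x y / x + y}.
Proof. by case=> ? ? []. Qed.

Lemma ImD (R : realType) : {morph @complex.Im R : x y / x + y}.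
Proof. by case=> ? ? []. Qed.

Lemma cvg_ReIm (R : realType) (f : nat -> R[i]^o) (a : R[i]^o) :
    f @ \oo --> a ->
  (fun n => complex.Re (f n)) @ \oo --> complex.Re a /\
  (fun n => complex.Im (f n)) @ \oo --> complex.Im a.
Proof.
move=> fa; have {fa}/cvg0_normc/cvgr0Pnorm_lt fa := (complex_subr_cvg0 f a).2 fa.
have le_normc (x : R[i]) : `|complex.Re x| <= normc x /\ `|complex.Im x| <= normc x.
  case: x => x y /=; rewrite -!sqrtr_sqr !ler_wsqrtr//.
    by rewrite lerDr sqr_ge0.
  by rewrite lerDl sqr_ge0.
have subE (x y : R[i]) : complex.Re (x - y) = complex.Re x - complex.Re y /\
   complex.Im (x - y) = complex.Im x - complex.Im y by case: x y => ? ? [].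
split; apply/cvgrPdist_lt => e e0; have := fa e e0; apply: filterS => n /=;
  rewrite (ger0_norm (le_trans (normr_ge0 _) (le_normc _).1)) distrC; apply: le_lt_trans.
- by rewrite -(subE _ _).1 (le_normc _).1.
- by rewrite -(subE _ _).2 (le_normc _).2.
Qed.

Lemma expi_natX (R : realType) (w : R) (k : nat) :
  ((cos w +i* sin w) ^- k = cos (w *+ k) -i* sin (w *+ k))%C.
Proof.
have -> : ((cos w +i* sin w) ^+ k = cos (w *+ k) +i* sin (w *+ k))%C.
  elim: k => [|k IHk]; first by rewrite expr0 mulr0n cos0 sin0.
  by rewrite exprS IHk mulrS cosD sinD; congr Complex; ring.
have := cos2Dsin2 (w *+ k); rewrite /GRing.inv /= => ->.
by rewrite !divr1.
Qed.

(** Real and imaginary parts of the expansion at e^(j w); at w = 0 the first one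
    gives the static gain. *)
Lemma impulse_response_trig (R : realType) (G : RHinf R) (w : R) :
  series (fun k => impulse_response G k * cos (w *+ k)) @ \oo -->
    complex.Re (freq_response G w) /\
  series (fun k => impulse_response G k * sin (w *+ k)) @ \oo -->
    - complex.Im (freq_response G w).
Proof.
have z1 : 1 <= `|(cos w +i* sin w)%C| by rewrite normc_def /= cos2Dsin2 sqrtr1.
have [] := cvg_ReIm (@impulse_response_cvg R G _ z1); rewrite -/(freq_response G w).
set SRe := (X in X @ _ --> _); set SIm := (X in _ -> X @ _ --> _ -> _).
have -> : SRe = series (fun k => impulse_response G k * cos (w *+ k)).
  apply/funext => n; rewrite /SRe /series /=.
  rewrite (big_morph _ (@ReD R) (erefl : complex.Re 0 = 0)).
  by apply: eq_bigr => k _; rewrite expi_natX /= mul0r subr0.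
have -> : SIm = - series (fun k => impulse_response G k * sin (w *+ k)).
  apply/funext => n; rewrite /SIm /series /=.
  rewrite (big_morph _ (@ImD R) (erefl : complex.Im 0 = 0)).
  transitivity (\sum_(0 <= k < n) - (impulse_response G k * sin (w *+ k))).
    by apply: eq_bigr => k _; rewrite expi_natX /= mul0r addr0 mulrN.
  by rewrite sumrN.
by move=> Re_cvg /(cvgN (FF := eventually_filter)); rewrite opprK.
Qed.

(** Expanding cos (w (m - k)) separates m from k, so that only the two series of
    impulse_response_trig occur. *)
Lemma sinusoid_output (R : realType) (G : RHinf R) (w c : R) :
  is_output G (fun m => cos (w *~ m) + c)
    (fun m => complex.Re (freq_response G w) * cos (w *~ m)
      - complex.Im (freq_response G w) * sin (w *~ m)
      + complex.Re (freq_response G 0) * c).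
Proof.
move=> m; have [cosw sinw] := impulse_response_trig G w.
have [dc _] := impulse_response_trig G 0.
have := cvgD (FF := eventually_filter)
  (cvgB (FF := eventually_filter)
    (cvgMr_tmp (FF := eventually_filter) (b := cos (w *~ m)) cosw)
    (cvgMr_tmp (FF := eventually_filter) (b := - sin (w *~ m)) sinw))
  (cvgMr_tmp (FF := eventually_filter) (b := c) dc).
rewrite mulrNN.
set S := (X in X @ _); set S' := series _.
suff -> : S = S' by [].
apply/funext => n; rewrite /S /S' /series /=.
transitivity (\sum_(0 <= k < n) (impulse_response G k * cos (w *+ k)) * cos (w *~ m)
  - \sum_(0 <= k < n) (impulse_response G k * sin (w *+ k)) * - sin (w *~ m)
  + \sum_(0 <= k < n) (impulse_response G k * cos (0 *+ k)) * c).
  by rewrite -!mulr_suml.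
rewrite -sumrB -big_split /=; apply: eq_bigr => k _.
by rewrite mul0rn cos0 mulrzBr pmulrn cosB; ring.
Qed.

(** * Interpolation by functions of restricted slope *)

(** A division-free form of slope restriction, meaningful also at x = y and
    preserved pointwise by minima. *)
Definition slope_in (R : realType) (k : R) (f : R -> R) : Prop :=
  forall x y, x <= y -> f x <= f y <= f x + k * (y - x).

Lemma slope_in_restricted (R : realType) (k : R) (f : R -> R) :
  slope_in k f -> slope_restricted k f.
Proof.
move=> fk y1 y2; case: (ltgtP y1 y2) => // y12 _.
  have /andP[le1 le2] := fk _ _ (ltW y12).
  rewrite divr_ge0 ?subr_ge0 ?(ltW y12)//=.
  by rewrite ler_pdivrMr ?subr_gt0//; lra.
have /andP[le1 le2] := fk _ _ (ltW y12).
rewrite -mulrNN -invrN !opprB divr_ge0 ?subr_ge0 ?(ltW y12)//=.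
by rewrite ler_pdivrMr ?subr_gt0//; lra.
Qed.

Lemma slope_in_ramp (R : realType) (k v a : R) : 0 <= k ->
  slope_in k (fun x => v + k * Num.max (x - a) 0).
Proof.
move=> k0 x y xy.
have [mono lip] : Num.max (x - a) 0 <= Num.max (y - a) 0 /\
    Num.max (y - a) 0 <= Num.max (x - a) 0 + (y - x).
  by case: (leP (x - a) 0) => ?; case: (leP (y - a) 0) => ?; split; lra.
have := ler_wpM2l k0 mono; have := ler_wpM2l k0 lip; lra.
Qed.

Lemma slope_in_bigmin (R : realType) (I : Type) (r : seq I) (k M : R)
    (F : I -> R -> R) :
    0 <= k -> (forall i, slope_in k (F i)) ->
  slope_in k (fun x => \big[Num.min/M]_(i <- r) F i x).
Proof.
move=> k0 Fk x y xy.
elim/big_ind2: _ => [|u1 w1 u2 w2 /andP[? ?] /andP[? ?]|i _]; last exact: Fk.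
  by rewrite lexx /= lerDl mulr_ge0 ?subr_ge0.
by case: (leP u1 u2) => ?; case: (leP w1 w2) => ?; apply/andP; split; lra.
Qed.

(** Through each point passes a ramp that is constant to its left and has slope k
    to its right.  The chord condition says that the ramp of each point passes
    above all the others, so the minimum of the ramps interpolates; it is bounded
    below, and taking M into the minimum bounds it above. *)
Lemma slope_in_interpolation (R : realType) (n : nat) (k M : R) (a v : nat -> R) :
    0 < k -> 0 <= M -> (forall i, `|v i| <= M) ->
    (forall i j, (i < n)%N -> (j < n)%N ->
      (v i - v j) ^+ 2 <= k * ((v i - v j) * (a i - a j))) ->
  exists f, [/\ slope_in k f, (forall x, `|f x| <= M) &
    forall i, (i < n)%N -> f (a i) = v i].
Proof.
move=> k0 M0 vM vk.
have v_itv i : - M <= v i <= M by rewrite -ler_norml.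
pose F i x := v i + k * Num.max (x - a i) 0.
have F_ge i x : v i <= F i x.
  by rewrite lerDl mulr_ge0 ?(ltW k0)// le_max lexx orbT.
exists (fun x => \big[Num.min/M]_(i < n) F i x); split.
- apply: (@slope_in_bigmin R 'I_n _ k M (fun i => F i) (ltW k0)) => i.
  by apply: slope_in_ramp; exact: ltW.
- move=> x; rewrite ler_norml bigmin_le_id andbT.
  apply: le_bigmin => [|i _]; first lra.
  by apply: le_trans (F_ge i x); have /andP[] := v_itv i.
- move=> i ltin; apply/le_anti/andP; split.
    apply: le_trans (bigmin_le _ (Ordinal ltin) _) _.
    by rewrite /F /= subrr maxxx mulr0 addr0.
  apply: le_bigmin => [|j _]; first by have /andP[] := v_itv i.
  have := vk i j ltin (ltn_ord j); rewrite /F leNgt => vkij; apply/negP.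
  case: (leP (a i - a j) 0) => [aij|/(mulr_gt0 k0) kaij] vji.
    have vij : 0 < v i - v j by lra.
    have := exprn_gt0 2 vij; have := mulr_ge0_le0 (ltW vij) aij.
    by move=> /(mulr_ge0_le0 (ltW k0)); lra.
  have vij : 0 < v i - v j by lra.
  have gap : 0 < v i - v j - k * (a i - a j) by lra.
  by have := mulr_gt0 vij gap; lra.
Qed.

(** The map c |-> c - f (d c) is continuous and changes sign between - M and M. *)
Lemma slope_in_fixpoint (R : realType) (k M d : R) (f : R -> R) : 0 <= k ->
  slope_in k f -> (forall x, `|f x| <= M) -> exists c, f (d * c) = c.
Proof.
move=> k0 fk fM.
have lip x y : `|f x - f y| <= k * `|x - y|.
  wlog xy : x y / x <= y => [W|].
    by case: (leP x y) => [|/ltW] /W //; rewrite distrC (distrC x).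
  have /andP[? ?] := fk _ _ xy.
  by rewrite distrC ger0_norm ?subr_ge0// distrC ger0_norm ?subr_ge0//; lra.
have fcont : continuous f.
  move=> x; apply/cvgrPdist_lt => e e0.
  have e'0 : 0 < e / (k + 1) by rewrite divr_gt0// ltr_wpDl.
  near=> y; apply: le_lt_trans (lip _ _) _.
  have : `|x - y| < e / (k + 1).
    by near: y; apply: cvgr_dist_lt.
  rewrite ltr_pdivlMr ?ltr_wpDl// => lt_e; apply: le_lt_trans lt_e.
  by rewrite mulrC ler_wpM2l// lerDl.
have hcont : continuous (fun c => c - f (d * c)).
  move=> c; apply: cvgB; first exact: cvg_id.
  by apply: (continuous_comp (f := fun c => d * c)); [exact: mulrl_continuous|exact: fcont].
have M0 : 0 <= M by rewrite (le_trans _ (fM 0)).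
have NMM : - M <= M by rewrite (le_trans _ M0)// oppr_le0.
have [|c _ /eqP] := IVT (v := 0) NMM (continuous_subspaceT hcont).
  have := fM (d * - M); have := fM (d * M); rewrite !ler_norml.
  by rewrite ge_min le_max; move=> /andP[? ?] /andP[? ?]; apply/andP; split;
    apply/orP; [left|right]; lra.
by rewrite subr_eq0 => /eqP fc; exists c.
Unshelve. all: by end_near. Qed.

(** * Sampled sinusoids *)

Lemma norm_sinDnpi (R : realType) (x : R) (n : nat) :
  `|sin (x + pi *+ n)| = `|sin x|.
Proof. by rewrite (alternatingn (@sinDpi R)) normrM normrX normrN1 expr1n mul1r. Qed.

(** The sine increases up to pi / 2, and r |-> T - r reflects the grid about
    pi / 2. *)
Lemma sin_pidiv_ge (R : realType) (T r : nat) : (0 < r < T)%N ->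
  sin (pi / T%:R) <= sin (pi * r%:R / T%:R) :> R.
Proof.
move=> /andP[r0 rT].
have T0 : 0 < T%:R :> R by rewrite ltr0n (leq_trans _ rT).
have T2 : 2 <= T%:R :> R by rewrite (ler_nat R 2) (leq_ltn_trans r0 rT).
have pi0 := pi_gt0 R.
have piT_gt0 : 0 < pi / T%:R :> R by rewrite divr_gt0.
have piT_le : pi / T%:R <= pi / 2 :> R by rewrite ler_pM2l// lef_pV2 ?posrE.
wlog half : r r0 rT / pi * r%:R / T%:R <= pi / 2 :> R => [W|].
  case: (leP (pi * r%:R / T%:R : R) (pi / 2)) => [|half]; first exact: W.
  have refl : pi * (T - r)%:R / T%:R = pi - pi * r%:R / T%:R :> R.
    by rewrite natrB 1?ltnW//; field; rewrite gt_eqF.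
  have := W (T - r)%N; rewrite refl => /(_ _ _ _)/le_trans; apply.
  - by rewrite subn_gt0.
  - by rewrite ltn_subrL r0 (leq_trans _ rT).
  - lra.
  - by rewrite sinB sinpi cospi mul0r sub0r mulN1r opprK.
have le_r : pi / T%:R <= pi * r%:R / T%:R :> R.
  by rewrite ler_pM2r ?invr_gt0// ler_peMr ?(ltW pi0)// ler1n.
move: le_r; rewrite le_eqVlt => /orP[/eqP -> //|lt_r]; apply: ltW.
by rewrite ltr_sin// in_itv /=; apply/andP; split; lra.
Qed.

Lemma sin_grid (R : realType) (T q : nat) : (0 < T)%N ->
  let s : R := pi * q%:R / T%:R in
  sin s = 0 \/ sin (pi / T%:R) <= `|sin s|.
Proof.
move=> T_gt0 s; have T0 : T%:R != 0 :> R by rewrite pnatr_eq0 -lt0n.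
have normE : `|sin s| = `|sin (pi * (q %% T)%:R / T%:R : R)|.
  rewrite -[RHS](norm_sinDnpi _ (q %/ T)); congr `|sin _|.
  by rewrite /s {1}(divn_eq q T) natrD natrM -mulr_natr; field.
have [r0|r_gt0] := posnP (q %% T)%N.
  left; apply/eqP; rewrite -normr_eq0 normE r0 mulr0 mul0r sin0 normr0.
  exact: eqxx.
right; rewrite normE; apply: le_trans (ler_norm _).
by apply: sin_pidiv_ge; rewrite r_gt0 ltn_mod.
Qed.

(** Outside its zeros, |sin s| >= sin t means |cos s| tan t <= |sin s|; combined
    with |I| <= - H tan t this bounds |I cos s| by - H |sin s|. *)
Lemma sector_form_le0 (R : realType) (t s H I : R) :
    0 < cos t -> 0 <= sin t -> H < 0 -> - `|I| / H <= tan t ->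
    sin s = 0 \/ sin t <= `|sin s| ->
  sin s * (H * sin s + I * cos s) <= 0.
Proof.
move=> ct st H0 IH [->|le_st]; first by rewrite mul0r.
have le_cs : `|cos s| <= cos t.
  rewrite -ler_sqr ?nnegrE ?normr_ge0 ?(ltW ct)// real_normK ?num_real//.
  rewrite !cos2sin2 lerD2l lerN2 -(real_normK (num_real (sin s))).
  by rewrite ler_sqr ?nnegrE ?normr_ge0.
have le_I : `|I| * cos t <= - H * sin t.
  move: IH; rewrite /tan ler_pdivlMr// mulrAC ler_ndivrMr//; lra.
have le_cross : `|I| * `|cos s| <= - H * `|sin s|.
  rewrite -(ler_pM2r ct).
  apply: (@le_trans _ _ (`|I| * cos t * `|cos s|)).
    by rewrite mulrAC.
  apply: (@le_trans _ _ (- H * sin t * cos t)).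
    by apply: ler_pM => //; rewrite mulr_ge0// ltW.
  by apply: ler_wpM2r; [exact: ltW|rewrite ler_wpM2l// oppr_ge0 ltW].
have : sin s * (I * cos s) <= `|sin s| * (`|I| * `|cos s|).
  by rewrite -!normrM ler_norm.
move=> /le_trans/(_ (ler_wpM2l (normr_ge0 (sin s)) le_cross)).
have := real_normK (num_real (sin s)); rewrite !expr2; set u := `|sin s|; nra.
Qed.

(** With the two phases written s + d and s - d, the form factors as
    4 sin^2 d times the form of sector_form_le0 at s, and s = pi q / T with
    q = a (i + j). *)
Lemma sampled_orbit_monotone (R : realType) (T a i j : nat) (w H I : R) :
    (2 < T)%N -> w = (pi *+ 2) * a%:R / T%:R ->
    H < 0 -> - `|I| / H <= tan (pi / T%:R) ->
  (cos (w *+ i) - cos (w *+ j)) *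
  (H * (cos (w *+ i) - cos (w *+ j)) - I * (sin (w *+ i) - sin (w *+ j))) <= 0.
Proof.
move=> T2 w_def H0 IH.
have T_gt0 : (0 < T)%N by rewrite (ltn_trans _ T2).
have T0 : 0 < T%:R :> R by rewrite ltr0n.
have pi0 := pi_gt0 R.
pose t : R := pi / T%:R.
have t_gt0 : 0 < t by rewrite divr_gt0.
have t_lt : t < pi / 2 by rewrite /t ltr_pM2l// ltf_pV2 ?posrE// (ltr_nat R 2).
have ct : 0 < cos t by apply: cos_gt0_pihalf; apply/andP; split; lra.
have st : 0 <= sin t by apply: sin_ge0_pi; apply/andP; split; lra.
pose s : R := pi * (a * (i + j))%:R / T%:R.
pose d : R := (w *+ i - w *+ j) / 2.
have wi : w *+ i = s + d.
  rewrite /s /d w_def natrM natrD -!(mulr_natr (_ / _)) -(mulr_natr pi).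
  by field; rewrite gt_eqF.
have wj : w *+ j = s - d.
  rewrite /s /d w_def natrM natrD -!(mulr_natr (_ / _)) -(mulr_natr pi).
  by field; rewrite gt_eqF.
rewrite wi wj !cosD !sinD cosN sinN.
have -> x y (c := cos s * x - sin s * y - (cos s * x - sin s * - y)) :
    c * (H * c - I * (sin s * x + cos s * y - (sin s * x + cos s * - y))) =
    4 * y ^+ 2 * (sin s * (H * sin s + I * cos s)).
  by rewrite /c; ring.
apply: mulr_ge0_le0; first by rewrite mulr_ge0// sqr_ge0.
exact: sector_form_le0 ct st H0 IH (sin_grid R _ T_gt0).
Qed.

(** * The periodic solution *)

Lemma periodicz (R : pzRingType) (V : Type) (f : R -> V) (P : R) :
  (forall x, f (x + P) = f x) -> forall (n : int) x, f (x + P *~ n) = f x.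
Proof.
move=> fP; have fPn n : forall x, f (x + P *+ n) = f x.
  by elim: n => [|n IHn] x; rewrite ?addr0// mulrSr addrA fP.
case=> n x; first exact: fPn.
by rewrite -[in RHS](subrK (P *+ n.+1) x) fPn.
Qed.

(** Both parities of alpha give an integer number of turns per period: alpha turns
    in 2 beta steps, or alpha / 2 turns in beta steps. *)
Lemma freqE (R : realType) (alpha beta : nat) : (0 < beta)%N ->
  freq R alpha beta =
    (pi *+ 2) * (if odd alpha then alpha else alpha./2)%:R
      / (period alpha beta)%:R.
Proof.
move=> beta0; rewrite /freq /period -mulr_natr.
have b0 : beta%:R != 0 :> R by rewrite pnatr_eq0 -lt0n.
case: ifP => odda; first by rewrite natrM; field.
have -> : alpha%:R = 2 * (alpha./2)%:R :> R.
  by rewrite -natrM mul2n halfK odda subn0.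
by field.
Qed.

Lemma period_gt2 (alpha beta : nat) : (0 < alpha)%N -> (alpha < beta)%N ->
  (2 < period alpha beta)%N.
Proof.
rewrite /period; case: ifP => [_ a0 ab|]; first lia.
by case: alpha => [|[|alpha]] // _ _ ab; lia.
Qed.

Theorem proposition1 (R : realType) (G : RHinf R) (alpha beta : nat) (k : R)
    (alpha_gt0 : (0 < alpha)%N) (alpha_lt_beta : (alpha < beta)%N)
    (alpha_beta_coprime : coprime alpha beta) (k_gt0 : 0 < k) :
  let w : R := freq R alpha beta in
  let T : nat := period alpha beta in
  let Rw : R := complex.Re (freq_response G w) in
  let Iw : R := complex.Im (freq_response G w) in
  Rw + k^-1 < 0 ->
  - `|Iw| / (Rw + k^-1) <= tan (pi / T%:R) ->
  exists phi : R -> R,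
    [/\ slope_restricted k phi, phi 0 = 0
      & has_nontrivial_periodic_solution G phi T].
Proof.
move=> w T Rw Iw H_lt0 sector.
have beta_gt0 : (0 < beta)%N := leq_ltn_trans (leq0n _) alpha_lt_beta.
have T2 : (2 < T)%N := period_gt2 alpha_gt0 alpha_lt_beta.
have w_def := freqE R alpha beta_gt0; rewrite -/w -/T in w_def.
set a := (if _ then _ else _) in w_def.
have T0 : T%:R != 0 :> R by rewrite pnatr_eq0 -lt0n (ltn_trans _ T2).
have wT : w *+ T = (pi *+ 2) *~ a%:Z.
  by rewrite w_def -(mulr_natr (_ / _)) divfK// mulr_natr.
have cos_per m n : cos (w *~ (m + T%:Z * n)) = cos (w *~ m).
  by rewrite mulrzDr mulrzA -pmulrn wT -mulrzA (periodicz (@cosD2pi R)).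
have sin_per m n : sin (w *~ (m + T%:Z * n)) = sin (w *~ m).
  by rewrite mulrzDr mulrzA -pmulrn wT -mulrzA (periodicz (@sinD2pi R)).
pose G0 := complex.Re (freq_response G 0).
pose y0 i := Rw * cos (w *+ i) - Iw * sin (w *+ i).
have [||i j _ _|f [fk f1 fy]] :=
  @slope_in_interpolation R T k 1 y0 (fun i => - cos (w *+ i)) k_gt0.
- exact: ler01.
- by move=> i; rewrite normrN cos_max.
- have := sampled_orbit_monotone i j T2 w_def H_lt0 sector.
  rewrite -(ler_pM2l k_gt0) mulr0 -[_ <= k * _]subr_ge0 => mono.
  suff -> : k * ((- cos (w *+ i) - - cos (w *+ j)) * (y0 i - y0 j)) -
      (- cos (w *+ i) - - cos (w *+ j)) ^+ 2 =
    - (k * ((cos (w *+ i) - cos (w *+ j)) *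
      ((Rw + k^-1) * (cos (w *+ i) - cos (w *+ j)) -
       Iw * (sin (w *+ i) - sin (w *+ j))))) by rewrite oppr_ge0.
  by rewrite /y0; field; rewrite gt_eqF.
(* With this c the shifted nonlinearity vanishes at 0. *)
have [c fc] := slope_in_fixpoint (- G0) (ltW k_gt0) fk f1.
exists (fun y => f (y - G0 * c) - c); split.
- apply: slope_in_restricted => x y xy.
  have := fk (x - G0 * c) (y - G0 * c); rewrite lerD2r => /(_ xy).
  by move=> /andP[? ?]; apply/andP; split; lra.
- by rewrite sub0r -mulNr fc subrr.
exists (fun m => cos (w *~ m) + c),
  (fun m => Rw * cos (w *~ m) - Iw * sin (w *~ m) + G0 * c); split.
- by move=> m; rewrite -[T%:Z]mulr1 cos_per.
- by move=> m; rewrite -[T%:Z]mulr1 cos_per sin_per.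
- split; first exact: sinusoid_output.
  move=> m; rewrite addrK.
  (* The interpolation covers the instants 0, ..., T - 1; reduce m to them. *)
  have Tz_gt0 : 0 < T%:Z by rewrite ltz_nat (ltn_trans _ T2).
  pose i := `|(m %% T%:Z)%Z|%N.
  have iE : i%:Z = (m %% T%:Z)%Z by rewrite gez0_abs// modz_ge0// gt_eqF.
  have iT : (i < T)%N by rewrite -ltz_nat iE ltz_pmod.
  have mE : m = i%:Z + T%:Z * (m %/ T%:Z)%Z by rewrite iE addrC mulrC -divz_eq.
  by rewrite mE cos_per sin_per -!pmulrn -/(y0 i) fy// opprD !opprK.
(* If u vanished at the instants 0 and 1, then cos 0 = cos w with 0 < w < pi. *)
move=> /[dup] /(_ 0) [u0 _] /(_ 1) [u1 _].
have pi0 := pi_gt0 R.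
have w0 : 0 < w by rewrite /w /freq divr_gt0 ?mulr_gt0 ?ltr0n.
have wpi : w < pi.
  by rewrite /w /freq ltr_pdivrMr ?ltr0n// mulrC ltr_pM2l ?ltr_nat.
have : cos w < cos 0.
  by rewrite ltr_cos// in_itv /= ?lexx ?(ltW pi0) ?(ltW w0) ?(ltW wpi).
by rewrite mulr0z mulr1z in u0 u1; lra.
Qed.
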